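(* Let $\psi$ be an elliptic isometry of three-dimensional Minkowski space $\mathbb{E}$ with fixed points, and suppose that $\psi$ is a rotation by a rational multiple of $2\pi$ about its line $\ell$ of fixed points. Let $\mathbb{E}_\psi=\mathbb{E}\setminus\ell$. Then $$\mathcal{F}(\langle\psi\rangle)=\mathbb{E}_\psi\qquad\text{and}\qquad\mathcal{T}(\langle\psi\rangle)=\emptyset,$$ that is, the CTC region of $\mathbb{E}_\psi/\langle\psi\rangle$ is empty.
   Context: $\mathbb{E}$ is the affine space modeled on $\mathbb{R}^{2,1}=\mathbb{R}^3$ with the form $\mathbb{B}((x,y,z),(u,v,w))=xu+yv-zw$. A vector $v$ is timelike if $\mathbb{B}(v,v)<0$. $\mathrm{Isom}(\mathbb{E})$ is the group of affine isometries $\gamma(p)=g(p)+v$, with linear part $g\in \mathrm{O}(2,1)$ and translational part $v\in\mathbb{R}^{2,1}$; only isometries preserving orientation and time-orientation (linear part in the identity component of $\mathrm{SO}(2,1)$) are considered. Such an isometry is elliptic if $\mathrm{tr}(g)<3$. The linear part of an elliptic isometry is conjugate, in the identity component of $\mathrm{SO}(2,1)$, to $$\psi_\theta=\begin{bmatrix}\cos\theta&\sin\theta&0\\-\sin\theta&\cos\theta&0\\0&0&1\end{bmatrix};$$ an elliptic isometry with a fixed point is conjugate by an isometry to $\psi_\theta$ acting linearly (with origin in the fixed point set), its fixed points form a line $\ell$ (the $z$-axis for $\psi_\theta$), and it is said to be a rotation by $\theta$ about $\ell$. Here $\Gamma=\langle\psi\rangle$ acts freely and properly discontinuously on $X=\mathbb{E}_\psi$,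 and $X/\Gamma$ is a flat Lorentz manifold. A timelike curve in $X/\Gamma$ is a $C^1$ path $c:[0,1]\to X/\Gamma$ all of whose tangent vectors are timelike; it is closed if $c(0)=c(1)$. The CTC region of $X/\Gamma$ is the set of points lying on some closed timelike curve. $\mathcal{T}(\Gamma)$ is the set of $p\in X$ whose image $[p]$ lies in the CTC region of $X/\Gamma$, and $\mathcal{F}(\Gamma)=X\setminus\mathcal{T}(\Gamma)$. *)

(* Defs.v *)
From HB Require Import structures.
From mathcomp Require Import all_boot all_order all_algebra.
From mathcomp Require Import all_classical all_reals all_analysis.

Set Implicit Arguments.
Unset Strict Implicit.
Unset Printing Implicit Defensive.

Import Order.TTheory GRing.Theory Num.Theory.
Import numFieldNormedType.Exports.

Local Open Scope classical_set_scope.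
Local Open Scope ring_scope.

(* Minkowski 3-space: column vectors, with an origin chosen, so that the
   same type serves for points and for translation vectors. *)
Notation mink R := ('cV[R]_3).

Section Isometries.
Variable R : realType.

Definition lorentz_form (u v : mink R) : R :=
  u 0 0 * v 0 0 + u 1 0 * v 1 0 - u 2 0 * v 2 0.

Definition timelike (v : mink R) : Prop := lorentz_form v v < 0.

Definition O21 : set 'M[R]_3 :=
  [set g | forall u v, lorentz_form (g *m u) (g *m v) = lorentz_form u v].

Definition SO21 : set 'M[R]_3 := [set g | O21 g /\ \det g = 1].

Definition SO21_0 : set 'M[R]_3 := connected_component SO21 1%:M.

(* Affine isometries preserving orientation and time-orientation. *)
Record isom := Isom {
  lin : 'M[R]_3;
  transl : mink R;
  lin_SO21_0 : SO21_0 lin }.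

Definition isom_fun (psi : isom) (p : mink R) : mink R :=
  lin psi *m p + transl psi.

Coercion isom_fun : isom >-> Funclass.

Definition isom_inv (psi : isom) (p : mink R) : mink R :=
  invmx (lin psi) *m (p - transl psi).

Definition elliptic (psi : isom) : Prop := \tr (lin psi) < 3.

Definition fixed_points (psi : isom) : set (mink R) := [set p | psi p = p].

Definition rot_mx (theta : R) : 'M[R]_3 :=
  \matrix_(i < 3, j < 3)
    (nth [::] [:: [:: cos theta;    sin theta; 0];
                  [:: - sin theta;  cos theta; 0];
                  [:: 0;            0;         1]] i)`_j.

(* When rot_mx theta <> 1, l is the image under h of the z-axis. *)
Definition is_rotation (psi : isom) (theta : R) (l : set (mink R)) : Prop :=
  l = fixed_points psi /\
  exists h : isom, forall p, psi (h p) = h (rot_mx theta *m p).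

Definition cyclic_group (psi : isom) : set (mink R -> mink R) :=
  [set f | exists n : nat, f = iter n psi \/ f = iter n (isom_inv psi)].

End Isometries.

Section Quotient.
Variable R : realType.
Variables (X : set (mink R)) (Gamma : set (mink R -> mink R)).

(* The quotient map X -> X/Gamma, points of the quotient being orbits. *)
Definition quot_map (p : mink R) : set (mink R) := [set f p | f in Gamma].

(* Open sets on which the quotient map is injective: the inverses of the
   restricted quotient maps are the charts of X/Gamma. *)
Definition chart_sheet (U : set (mink R)) : Prop :=
  [/\ open U, U `<=` X & set_inj U quot_map].

(* f is C^1 on J with derivative df; difference quotients are taken inside J,
   hence one-sidedly at an endpoint of J. *)
Definition C1_on (J : set R) (f df : R -> mink R) : Prop :=
  (forall t, J t ->
     (fun s => (s - t)^-1 *: (f s - f t)) @ within J t^' --> df t) /\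
  {within J, continuous df}.

(* c : [0,1] -> X/Gamma is C^1 with timelike tangent vectors: near each time,
   c stays in the image of some sheet U and is there read in the chart as the
   map f. Values of c outside [0,1] are irrelevant. *)
Definition timelike_curve (c : R -> set (mink R)) : Prop :=
  forall t : R, t \in `[0, 1] ->
  exists (U : set (mink R)) (e : R) (f df : R -> mink R),
    let J := `[0, 1]%classic `&` ball t e in
    [/\ chart_sheet U, 0 < e,
        forall s : R, J s -> U (f s) /\ c s = quot_map (f s),
        C1_on J f df &
        forall s : R, J s -> timelike (df s)].

Definition closed_timelike_curve (c : R -> set (mink R)) : Prop :=
  timelike_curve c /\ c 0 = c 1.

Definition CTC_region : set (set (mink R)) :=
  [set x | exists2 c, closed_timelike_curve c &
             exists2 t : R, t \in `[0, 1] & c t = x].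

Definition calT : set (mink R) := [set p | X p /\ CTC_region (quot_map p)].

Definition calF : set (mink R) := X `\` calT.

End Quotient.

(* Main.v *)
Require Import Defs.
From HB Require Import structures.
From mathcomp Require Import all_boot all_order all_algebra.
From mathcomp Require Import all_classical all_reals all_analysis.
Set Implicit Arguments.
Unset Strict Implicit.
Unset Printing Implicit Defensive.
Import Order.TTheory GRing.Theory Num.Theory.
Import numFieldNormedType.Exports.
Local Open Scope classical_set_scope.
Local Open Scope ring_scope.

(** Let [h] conjugate [psi] to a rotation about the z-axis. The time function
    [p |-> z (h^-1 p)] is invariant under [psi], hence descends to the quotient.
    Along a timelike curve its derivative is the z-coordinate of a timelike
    vector, so it never vanishes, and by Rolle's theorem the function takes
    different values at the two ends of the curve. *)

Section DifferenceQuotients.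
Variable R : realType.
Implicit Types (D E : set R) (g k : R -> R) (t d e : R).

(** Only [s] in [D] count, as in [C1_on], so at an endpoint of an interval this is a one-sided
    derivative. *)
Definition has_derive_within D g t d : Prop :=
  (fun s => (s - t)^-1 * (g s - g t)) @ within D t^' --> d.

(** Away from [t], [g s - g t] is [s - t], which tends to 0, times a convergent quotient. The point
    [t] itself is then added to the neighbourhood by hand. *)
Lemma has_derive_within_cvg D g t d :
  has_derive_within D g t d -> g @ within D (nbhs t) --> g t.
Proof.
move=> gd; have st0 : (fun s => s - t) @ within D t^' --> 0.
  have st : (fun s => s - t) @ t --> t - t.
    by apply: cvgB; [exact: cvg_id|exact: cvg_cst].
  rewrite subrr in st.
  by apply: cvg_within_filter; apply: cvg_within_filter.
have gst := cvgM st0 gd; rewrite mul0r in gst.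
move=> A /nbhs_ballP[e /= e0 eA].
have /nbhs_ballP[r /= r0 rA] : t^' (fun s => D s ->
    ball 0 e ((s - t) * ((s - t)^-1 * (g s - g t)))).
  exact: gst (nbhsx_ballx _ _ e0).
apply/nbhs_ballP; exists r => //= s ts Ds; apply: eA.
have [->|st] := eqVneq s t; first exact: ballxx.
have := rA s ts st Ds.
by rewrite mulrA divff ?subr_eq0// mul1r /ball/= sub0r normrN distrC.
Qed.

(** Near [t] the restriction to [D] is vacuous, and [s = u + t] turns the quotient into one in the
    increment [u]. *)
Lemma has_derive_within_is_derive D g t d :
  nbhs t D -> has_derive_within D g t d -> is_derive t 1 g d.
Proof.
move=> tD gd.
suff dq : (fun u => u^-1 *: ((g \o shift t) (u *: 1) - g t)) @ 0^' --> d.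
  by apply: DeriveDef; [apply/cvg_ex; exists d|apply: cvg_lim].
move=> A /gd; rewrite /within/= => tA.
have {tD}/nbhs_ballP[r /= r0 rA] : nbhs t (fun s => s != t ->
    A ((s - t)^-1 * (g s - g t))).
  by apply: filterS2 tD tA => s Ds /[swap] st; apply.
apply/nbhs_ballP; exists r => //= u; rewrite /ball/= sub0r normrN => ur u0.
have := rA (u + t); rewrite /ball/= opprD addrCA subrr addr0 normrN addrK.
rewrite -subr_eq0 addrK => /(_ ur u0).
by rewrite /= /shift/= -[u *: 1]/(u * 1) mulr1.
Qed.

(** Contrapositive of Rolle: the one-sided derivatives at [a] and [b] serve only to give continuity
    there. *)
Lemma has_derive_within_neq a b g : a < b ->
  (forall t, t \in `[a, b] ->
    exists2 d, d != 0 & has_derive_within `[a, b]%classic g t d) ->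
  g a <> g b.
Proof.
move=> ab gd gab.
have gD t : t \in `]a, b[ -> exists2 d, d != 0 & is_derive t 1 g d.
  move=> tab; have [d d0 td] := gd t (subset_itv_oo_cc tab).
  exists d => //; apply: has_derive_within_is_derive td.
  by apply: filterS (near_in_itvoo tab) => s /subset_itv_oo_cc.
have gderivable t : t \in `]a, b[ -> derivable g t 1 by move=> /gD[d _ []].
have gcont : {within `[a, b], continuous g}.
  apply/subspace_continuousP => t tab.
  by have [d _ /has_derive_within_cvg] := gd t tab.
have [t /gD[d d0 td] t0] := Rolle ab gderivable gcont gab.
by move: d0; rewrite -(@derive_val _ _ _ _ _ _ _ td) derive_val eqxx.
Qed.

(** Derivatives are local: this transfers one from a chart reading, available only near [t], to a
    function on the whole interval. *)
Lemma has_derive_within_ball D g k t d e : 0 < e -> D t ->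
  {in D `&` ball t e, g =1 k} ->
  has_derive_within (D `&` ball t e) k t d -> has_derive_within D g t d.
Proof.
move=> e0 Dt gk kd A /kd; rewrite /within/= => tA.
have te : t^' (ball t e) by apply: nbhs_dnbhs; exact: nbhsx_ballx.
apply: filterS2 te tA => s tes /[swap] Ds /(_ (conj Ds tes)).
by rewrite /= !gk ?inE//; split => //; exact: ballxx.
Qed.

End DifferenceQuotients.

Section TimeFunction.
Variable R : realType.
Implicit Types (h psi : isom R) (p v : mink R) (theta : R).

Lemma isom_lin_unit psi : lin psi \in unitmx.
Proof.
have [_ d1] := connected_component_sub (lin_SO21_0 psi).
by rewrite unitmxE d1 unitr1.
Qed.

Lemma isomK psi : cancel psi (isom_inv psi).
Proof. by move=> p; rewrite /isom_inv /isom_fun addrK mulKmx ?isom_lin_unit. Qed.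

Lemma isom_invK psi : cancel (isom_inv psi) psi.
Proof.
by move=> p; rewrite /isom_inv /isom_fun mulKVmx ?isom_lin_unit// subrK.
Qed.

(** The inverse of [lin h] preserves the form, and on a vector with zero z-coordinate the form is a
    sum of two squares. *)
Lemma isom_inv_timelike h v : timelike v -> (invmx (lin h) *m v) 2 0 != 0.
Proof.
have [h21 _] := connected_component_sub (lin_SO21_0 h).
rewrite /timelike -{1 2}(mulKVmx (isom_lin_unit h) v) h21 /lorentz_form.
apply: contraTneq => ->; rewrite mulr0 subr0 -leNgt.
by rewrite addr_ge0// -expr2 sqr_ge0.
Qed.

Definition time h p : R := isom_inv h p 2 0.

Lemma timeB h p p' : time h p - time h p' = (invmx (lin h) *m (p - p')) 2 0.
Proof.
have -> : p - p' = (p - transl h) - (p' - transl h) by rewrite opprB addrA subrK.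
by rewrite mulmxBr [RHS]mxE [X in _ = _ + X]mxE.
Qed.

Lemma mulmx_coord_cvg (M : 'M[R]_3) (i : 'I_3) (F : set_system R) {FF : Filter F}
    (f : R -> mink R) v :
  f @ F --> v -> (fun s => (M *m f s) i 0) @ F --> (M *m v) i 0.
Proof.
move=> fv.
have -> : (M *m v) i 0 = \sum_j M i j * v j 0 by rewrite mxE.
have -> : (fun s => (M *m f s) i 0) = (fun s => \sum_j M i j * f s j 0).
  by apply/funext => s; rewrite mxE.
rewrite !big_ord_recr !big_ord0/=.
have vj j : (fun s => M i j * f s j 0) @ F --> M i j * v j 0.
  apply: cvgMr; exact: (cvg_comp _ _ fv (@coord_continuous _ _ _ j 0 v)).
under eq_fun do rewrite !big_ord_recr big_ord0/=.
by apply: cvgD => //; apply: cvgD => //; apply: cvgD => //; exact: cvg_cst.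
Qed.

Lemma has_derive_within_time h (J : set R) (f : R -> mink R) (t : R) v :
  (fun s => (s - t)^-1 *: (f s - f t)) @ within J t^' --> v ->
  has_derive_within J (time h \o f) t ((invmx (lin h) *m v) 2 0).
Proof.
move=> fv; rewrite /has_derive_within.
have -> : (fun s => (s - t)^-1 * ((time h \o f) s - (time h \o f) t)) =
    (fun s => (invmx (lin h) *m ((s - t)^-1 *: (f s - f t))) 2 0).
  by apply/funext => s; rewrite /= timeB -scalemxAr [RHS]mxE.
exact: mulmx_coord_cvg fv.
Qed.

Lemma rot_mx_z theta v : (rot_mx theta *m v) 2 0 = v 2 0.
Proof.
rewrite mxE !big_ord_recr big_ord0/= !mxE/= !mul0r !add0r mul1r.
by congr (v _ _); exact: val_inj.
Qed.

Section Quotient.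
Variables (h psi : isom R) (theta : R).
Hypothesis psi_h : forall p, psi (h p) = h (rot_mx theta *m p).

(** In the coordinates given by [h], [psi] is [rot_mx theta], which keeps z. *)
Lemma time_isom p : time h (psi p) = time h p.
Proof.
by rewrite -{1}(isom_invK h p) psi_h /time isomK rot_mx_z.
Qed.

Lemma time_isom_inv p : time h (isom_inv psi p) = time h p.
Proof. by rewrite -time_isom isom_invK. Qed.

Lemma time_cyclic_group gamma p :
  cyclic_group psi gamma -> time h (gamma p) = time h p.
Proof.
move=> [n [->|->]]; elim: n => //= n; first by rewrite time_isom.
by rewrite time_isom_inv.
Qed.

(** An arbitrary point of the orbit is chosen; the default 0 concerns only the empty set. *)
Definition quot_time (x : set (mink R)) : R := time h (xget 0 x).

Lemma quot_time_map p : quot_time (quot_map (cyclic_group psi) p) = time h p.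
Proof.
rewrite /quot_time; case: xgetP => [_ -> [gamma Ggamma <-]|/(_ p)[]].
  exact: time_cyclic_group.
(* The orbit is nonempty: it contains [p], the identity being the zeroth iterate. *)
by exists id => //; exists 0%N; left.
Qed.

(** The sheet [U] and the reading [f] vary with [t], but [quot_time \o c] is one function on all of
    [0,1], equal to [time h \o f] near [t]; hence [c] need not be lifted globally. *)
Lemma no_closed_timelike_curve X c :
  ~ closed_timelike_curve X (cyclic_group psi) c.
Proof.
move=> [tc c01]; have := congr1 quot_time c01.
apply: (@has_derive_within_neq _ 0 1 (quot_time \o c)) => // t t01.
have [U [e [f [df [_ e0 cf [fdf _] dft]]]]] := tc t t01.
have Jt : (`[0, 1]%classic `&` ball t e) t by split => //; exact: ballxx.
exists ((invmx (lin h) *m df t) 2 0); first exact/isom_inv_timelike/dft.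
apply: (@has_derive_within_ball _ _ _ (time h \o f) _ _ e) => //.
  by move=> s; rewrite inE => /cf[_ /= ->]; rewrite quot_time_map.
exact/has_derive_within_time/fdf.
Qed.

End Quotient.
End TimeFunction.

Theorem proposition4p1 (R : realType) (psi : isom R) (l : set (mink R)) (q : rat)
    (psi_elliptic : elliptic psi)
    (psi_fixed : fixed_points psi !=set0)
    (psi_rot : is_rotation psi (ratr q * (2 * pi)) l) :
  let E_psi := ~` l in
  let Gamma := cyclic_group psi in
  [/\ calF E_psi Gamma = E_psi,
      calT E_psi Gamma = set0 &
      CTC_region E_psi Gamma = set0].
Proof.
move=> E_psi Gamma; have [_ [h psi_h]] := psi_rot.
have CTC0 : CTC_region E_psi Gamma = set0.
  by apply/seteqP; split => // x [c /(no_closed_timelike_curve psi_h)].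
have T0 : calT E_psi Gamma = set0.
  by apply/seteqP; split => // p []; rewrite CTC0.
by rewrite /calF T0 setD0.
Qed.
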